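(* Let $A$ be a non-empty subset of $\mathbb{N}$ and let $B$ be a non-empty finite subset of $\mathbb{N}\setminus\{0\}$. Then $\mathscr{S}(A,B)\neq\emptyset$ if and only if $B\cap\langle A\rangle=\emptyset$.
   Context: $\mathbb{N}=\{0,1,2,\ldots\}$. $\langle A\rangle$ is the submonoid of $(\mathbb{N},+)$ generated by $A$. A numerical semigroup is a submonoid $S$ of $(\mathbb{N},+)$ with $\mathbb{N}\setminus S$ finite. $\mathscr{S}(A,B)$ is the set of all numerical semigroups $S$ such that $A\subseteq S$ and $S\cap B=\emptyset$. *)

(* Defs.v *)
From mathcomp Require Import all_boot.
From mathcomp Require Import boolp classical_sets cardinality.

Set Implicit Arguments.
Unset Strict Implicit.
Unset Printing Implicit Defensive.

Local Open Scope classical_set_scope.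

Definition submonoid (M : set nat) : Prop :=
  M 0 /\ forall x y, M x -> M y -> M (x + y).

(* The intersection of all submonoids of nat that contain A. *)
Definition generated_submonoid (A : set nat) : set nat := smallest submonoid A.

Definition numerical_semigroup (S : set nat) : Prop :=
  submonoid S /\ finite_set (~` S).

Definition numerical_semigroups (A B : set nat) : set (set nat) :=
  [set S | [/\ numerical_semigroup S, A `<=` S & S `&` B = set0]].

(* Main.v *)
Require Import Defs.
From mathcomp Require Import all_boot.
From mathcomp Require Import boolp classical_sets cardinality.

(** Any semigroup in the family is a submonoid containing [A], so it contains
the submonoid generated by [A] and can avoid [B] only if that one does.
Conversely, a generated submonoid that avoids [B] may still have infinite
complement, but adding to it every integer above a bound of the finite set [B]
makes the complement finite, keeps the set closed under addition (a sum with a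
large summand is large), and adds no element of [B]. *)

Local Open Scope classical_set_scope.

Lemma generated_submonoid_submonoid (A : set nat) :
  submonoid (generated_submonoid A).
Proof.
split=> [M [[M0 _] _]//|x y Ax Ay M MA].
by case: (MA) => -[_ MD] _; apply: MD; [exact: Ax|exact: Ay].
Qed.

Lemma finite_set_nat_bounded (B : set nat) :
  finite_set B -> exists N, forall b, B b -> b <= N.
Proof.
move=> /finite_seqP[s ->]; exists (\max_(b <- s) b) => b /= bs.
exact: leq_bigmax_seq.
Qed.

Lemma submonoid_setU_gt_numerical_semigroup (M : set nat) (N : nat) :
  submonoid M -> numerical_semigroup (M `|` [set n | N < n]).
Proof.
move=> [M0 MD]; split.
  split=> [|x y]; first by left.
  case=> [Mx|/= Nx]; last by right; rewrite /= ltn_addr.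
  by case=> [My|/= Ny]; [left; exact: MD|right; rewrite /= ltn_addl].
apply: (sub_finite_set _ (finite_II N.+1)) => n /= notMn.
by rewrite ltnS leqNgt; apply/negP => Nn; apply: notMn; right.
Qed.

Theorem proposition5p1 (A B : set nat) (A_neq0 : A !=set0) (B_neq0 : B !=set0)
    (B_finite : finite_set B) (B_pos : B `<=` [set~ 0]) :
  numerical_semigroups A B !=set0 <-> B `&` generated_submonoid A = set0.
Proof.
split=> [[S [[S_submonoid _] AS SB0]]|BA0].
  rewrite -subset0 -SB0 => b [Bb Ab].
  by split=> //; exact: (Ab S).
have [N BN] := finite_set_nat_bounded B B_finite.
exists (generated_submonoid A `|` [set n | N < n]); split.
- apply: submonoid_setU_gt_numerical_semigroup.
  exact: generated_submonoid_submonoid.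
- by move=> a Aa; left; exact: sub_smallest Aa.
- rewrite -subset0 => b [[Ab|/= Nb] Bb]; first by rewrite -BA0.
  by move: (BN b Bb); rewrite leqNgt Nb.
Qed.
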